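(* Let $M$ be the Fraïssé limit of a relational amalgamation class $\mathcal K$ (in a language $L$). Let $\prec$ be a linear ordering of some subset $I\subseteq M$, and consider the expansion $(M,I,\prec)$ by a new unary and a new binary relation symbol. Let $T$ be $Th(M)$ extended by all sentences from $Th(M,I,\prec)$ of the form $\forall\bar x\,\neg D(\bar x)$, where $D(\bar x)$ is a basic formula for $(M,I,\prec)$. Suppose that for every $n\ge1$ and every sequence $\bar a_i$, $i<\omega$, of $n$-tuples from $M$ there exist $i<j<\omega$ and an elementary map $f:M\to M$ which is an isomorphic embedding of $(M,I,\prec)$ into itself with $f(\bar a_i)=\bar a_j$. Then the space of all expansions of $M$ to models of $T$ contains a generic structure, and this generic structure is $\omega$-categorical. In particular this conclusion holds when $I=M$ and $\prec$ is an AZ-enumeration of $M$.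
   Context: A basic formula for an expansion $(M,\bar{\mathbf r})$ is one of the form $\phi(\bar x)\wedge\psi(\bar x)$ where $\psi$ is a complete (type-isolating) formula of $Th(M)$ and $\phi$ is a diagram of the new symbols on $\bar x$, i.e. a conjunction choosing for each new relation symbol and each tuple of variables from $\bar x$ of appropriate length either the atomic formula or its negation. The space $\mathbf X$ of all expansions of $M$ to models of $T$ is topologized by basic clopen sets $[D(\bar a)]=\{(M,\bar{\mathbf r}')\in\mathbf X:(M,\bar{\mathbf r}')\models D(\bar a)\}$, $\bar a\subseteq M$ finite, $D$ basic; a structure in $\mathbf X$ is generic if its orbit under $Aut(M)$ is comeagre in $\mathbf X$. A linear ordering $\prec$ of $M$ of order type $\omega$ is an AZ-enumeration of $M$ if for every $n\ge1$ and every sequence $\bar b_i$, $i<\omega$, of $n$-tuples from $M$ there exist $i<j<\omega$ and a $\prec$-preserving $Th(M)$-elementary map $f:M\to M$ with $f(\bar b_i)=\bar b_j$. *)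

(* Defs.v *)
From HB Require Import structures.
From mathcomp Require Import all_boot.
From mathcomp Require Import all_classical topology.

Set Implicit Arguments.
Unset Strict Implicit.
Unset Printing Implicit Defensive.

Local Open Scope classical_set_scope.

Record language := Language { symbol : Type; arity : symbol -> nat }.

(* Empty carriers are allowed. *)
Record structure (L : language) := Structure {
  carrier :> Type;
  interp : forall r : symbol L, ('I_(arity r) -> carrier) -> Prop }.

(* Formulas whose free variables are among x_0, ..., x_(n-1).  [fall] binds
   the variable [ord0]; the remaining ones are shifted by [lift ord0]. *)
Inductive formula (L : language) : nat -> Type :=
| fbot n : formula L n
| feq n : 'I_n -> 'I_n -> formula L n
| frel n (r : symbol L) : ('I_(arity r) -> 'I_n) -> formula L n
| fimp n : formula L n -> formula L n -> formula L n
| fall n : formula L n.+1 -> formula L n.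
Arguments fbot {L n}.
Arguments feq {L n} _ _.
Arguments frel {L n} r _.

Section Formulas.
Variable L : language.

Definition fneg n (p : formula L n) : formula L n := fimp p fbot.
Definition ftrue n : formula L n := fneg fbot.
Definition fand n (p q : formula L n) : formula L n := fneg (fimp p (fneg q)).

Fixpoint univ_closure n : formula L n -> formula L 0 :=
  if n is m.+1 then fun p => univ_closure (fall p) else id.

Definition scons (A : Type) n (x : A) (e : 'I_n -> A) (i : 'I_n.+1) : A :=
  if unlift ord0 i is Some j then e j else x.

Fixpoint sat (A : structure L) n (p : formula L n) : ('I_n -> A) -> Prop :=
  match p in formula _ n return ('I_n -> A) -> Prop with
  | fbot _ => fun _ => False
  | feq _ i j => fun e => e i = e j
  | frel _ r v => fun e => interp (e \o v)
  | fimp _ p q => fun e => sat p e -> sat q e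
  | fall _ p => fun e => forall x : A, sat p (scons x e)
  end.

Definition no_vars (A : Type) (i : 'I_0) : A :=
  False_rect A (notF (ltn_ord i)).

Definition theory (A : structure L) : set (formula L 0) :=
  [set s | sat s (@no_vars A)].

Definition models (A : structure L) (T : set (formula L 0)) : Prop :=
  T `<=` theory A.

(* [p] isolates a complete type of the theory of [A]; as that theory is
   complete, provability from it is membership in it. *)
Definition complete_formula (A : structure L) n (p : formula L n) : Prop :=
  ~ theory A (univ_closure (fneg p)) /\
  forall q : formula L n, theory A (univ_closure (fimp p q)) \/
                          theory A (univ_closure (fimp p (fneg q))).

Definition embedding (A B : structure L) (f : A -> B) : Prop :=
  injective f /\
  forall (r : symbol L) (a : 'I_(arity r) -> A),
    interp a <-> interp (f \o a).

Definition isomorphism (A B : structure L) (f : A -> B) : Prop :=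
  bijective f /\ embedding f.

Definition automorphism (A : structure L) (f : A -> A) : Prop :=
  isomorphism f.

Definition elementary (A B : structure L) (f : A -> B) : Prop :=
  forall n (p : formula L n) (e : 'I_n -> A), sat p e <-> sat p (f \o e).

Definition embeds (A B : structure L) : Prop :=
  exists f : A -> B, embedding f.

Definition isomorphic (A B : structure L) : Prop :=
  exists f : A -> B, isomorphism f.

(* For an infinite [A] the countable models of its theory are exactly the
   countably infinite ones. *)
Definition omega_categorical (A : structure L) : Prop :=
  countable [set: A] /\
  forall B : structure L,
    countable [set: B] -> models B (theory A) -> isomorphic A B.

(* Closure under isomorphism is a case of the hereditary property [ac_hp]. *)
Record amalgamation_class (K : set (structure L)) : Prop := {
  ac_nonempty : K !=set0;
  ac_finite : forall A, K A -> finite_set [set: A];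
  ac_countable : exists E : nat -> structure L,
    forall A, K A -> exists i, isomorphic A (E i);
  ac_hp : forall A B, K B -> embeds A B -> K A;
  ac_jep : forall A B, K A -> K B ->
    exists C, [/\ K C, embeds A C & embeds B C];
  ac_ap : forall (A B C : structure L) (f : A -> B) (g : A -> C),
    K A -> K B -> K C -> embedding f -> embedding g ->
    exists (D : structure L) (f' : B -> D) (g' : C -> D),
      [/\ K D, embedding f', embedding g' & f' \o f = g' \o g] }.

Definition age (M : structure L) : set (structure L) :=
  [set A : structure L | finite_set [set: A] /\ embeds A M].

(* [p] restricts to an isomorphism from the substructure [S] onto the
   substructure [p @` S]. *)
Definition partial_isomorphism (M : structure L) (S : set M) (p : M -> M) :=
  set_inj S p /\
  forall (r : symbol L) (a : 'I_(arity r) -> M),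
    (forall i, S (a i)) -> (interp a <-> interp (p \o a)).

Definition ultrahomogeneous (M : structure L) : Prop :=
  forall (S : set M) (p : M -> M),
    finite_set S -> partial_isomorphism S p ->
    exists h : M -> M, automorphism h /\ forall x, S x -> h x = p x.

Definition fraisse_limit (K : set (structure L)) (M : structure L) : Prop :=
  [/\ countable [set: M], ultrahomogeneous M & age M = K].

End Formulas.

Record signature := Signature { new_symbol : finType;
                                new_arity : new_symbol -> nat }.

Definition lang_expand (L : language) (R : signature) : language :=
  @Language (symbol L + new_symbol R)%type
    (fun s => match s with inl r => arity r | inr r => new_arity r end).

Definition relations (R : signature) (A : Type) : Type :=
  forall r : new_symbol R, ('I_(new_arity r) -> A) -> Prop.

Definition expand (L : language) (R : signature) (M : structure L)
    (E : relations R M) : structure (lang_expand L R) :=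
  @Structure (lang_expand L R) M
    (fun s => match s return ('I_(@arity (lang_expand L R) s) -> M) -> Prop with
              | inl r => @interp L M r
              | inr r => E r
              end).

Fixpoint lift_formula (L : language) (R : signature) n (p : formula L n) :
    formula (lang_expand L R) n :=
  match p in formula _ n return formula (lang_expand L R) n with
  | fbot _ => fbot
  | feq _ i j => feq i j
  | frel _ r v => @frel (lang_expand L R) _ (inl r) v
  | fimp _ p q => fimp (lift_formula R p) (lift_formula R q)
  | fall _ p => fall (lift_formula R p)
  end.

Section Expansions.
Variables (L : language) (R : signature).
Local Notation L' := (lang_expand L R).

Definition new_atom n (r : new_symbol R) (v : 'I_(new_arity r) -> 'I_n) :
    formula L' n :=
  @frel L' n (inr r) v.

Definition diagram n
    (d : forall r : new_symbol R, {ffun 'I_(new_arity r) -> 'I_n} -> bool) :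
    formula L' n :=
  \big[@fand L' n/@ftrue L' n]_(r : new_symbol R)
    \big[@fand L' n/@ftrue L' n]_(v : {ffun 'I_(new_arity r) -> 'I_n})
      (if d r v then new_atom v else fneg (new_atom v)).

Variable M : structure L.

Definition basic_formula n (D : formula L' n) : Prop :=
  exists d (p : formula L n),
    complete_formula M p /\ D = fand (diagram d) (lift_formula R p).

Definition basic_theory (E0 : relations R M) : set (formula L' 0) :=
  [set lift_formula R s | s in theory M] `|`
  [set s | theory (expand E0) s /\
           exists n (D : formula L' n),
             basic_formula D /\ s = univ_closure (fneg D)].

Definition expansion_space (T : set (formula L' 0)) : Type :=
  {E : relations R M | models (expand E) T}.

Definition basic_clopen (T : set (formula L' 0)) n (D : formula L' n)
    (a : 'I_n -> M) : set (expansion_space T) :=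
  [set E | @sat L' (expand (sval E)) n D a].

Definition basic_clopens (T : set (formula L' 0)) :
    set (set (expansion_space T)) :=
  [set U | exists n (D : formula L' n) (a : 'I_n -> M),
             basic_formula D /\ U = @basic_clopen T n D a].

(* The basic clopen sets form a base when every tuple of [M] realizes an
   isolated type; in general they are taken as a subbase. *)
HB.instance Definition _ (T : set (formula L' 0)) :=
  gen_eqMixin (expansion_space T).
HB.instance Definition _ (T : set (formula L' 0)) :=
  gen_choiceMixin (expansion_space T).
HB.instance Definition _ (T : set (formula L' 0)) :=
  isSubBaseTopological.Build (expansion_space T) (@basic_clopens T) id.

Definition aut_orbit (T : set (formula L' 0)) (E : expansion_space T) :
    set (expansion_space T) :=
  [set E' | exists g : M -> M, automorphism g /\
     forall (r : new_symbol R) (a : 'I_(new_arity r) -> M),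
       sval E r a <-> sval E' r (g \o a)].

End Expansions.

Definition comeagre (X : topologicalType) (A : set X) : Prop :=
  exists U : nat -> set X,
    (forall i, open (U i) /\ dense (U i)) /\ \bigcap_i U i `<=` A.

Definition generic (L : language) (R : signature) (M : structure L)
    (T : set (formula (lang_expand L R) 0)) (E : expansion_space M T) : Prop :=
  comeagre (aut_orbit E).

(* [false] is the unary symbol I, [true] the binary symbol for the order. *)
Definition order_signature : signature :=
  @Signature bool (fun b => if b then 2 else 1).

Definition order_relations (A : Type) (I : set A) (prec : A -> A -> Prop) :
    relations order_signature A :=
  fun b => match b return ('I_(@new_arity order_signature b) -> A) -> Prop with
           | true => fun a => prec (a ord0) (a ord_max)
           | false => fun a => I (a ord0)
           end.

Record linear_order_on (A : Type) (I : set A) (prec : A -> A -> Prop) : Prop := {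
  lo_sub : forall x y, prec x y -> I x /\ I y;
  lo_irrefl : forall x, ~ prec x x;
  lo_trans : forall x y z, prec x y -> prec y z -> prec x z;
  lo_total : forall x y, I x -> I y -> x <> y -> prec x y \/ prec y x }.

Definition order_type_omega (A : Type) (prec : A -> A -> Prop) : Prop :=
  exists e : nat -> A, bijective e /\ forall i j, prec (e i) (e j) <-> (i < j)%N.

Definition AZ_enumeration (L : language) (M : structure L)
    (prec : M -> M -> Prop) : Prop :=
  [/\ linear_order_on [set: M] prec, order_type_omega prec &
      forall n (b : nat -> 'I_n -> M), (1 <= n)%N ->
        exists i j (f : M -> M),
          [/\ (i < j)%N, elementary f,
              forall x y, prec x y -> prec (f x) (f y) & f \o b i = b j]].

Definition has_omega_categorical_generic (L : language) (R : signature)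
    (M : structure L) (T : set (formula (lang_expand L R) 0)) : Prop :=
  (exists G : expansion_space M T, generic G) /\
  forall G : expansion_space M T, generic G ->
    omega_categorical (expand (sval G)).

(* Main.v *)
(**
Write E0 for the given expansion.  As M has finitely many types of n-tuples, all
isolated, the space of expansions is the closure of the Aut(M)-orbit of E0, with
the topology of agreement on finite sets.

Consider finite pieces of expansions in the space, with a distinguished base
tuple, ordered by Aut(M)-embeddings that preserve the base.  Every piece occurs
in E0, so the self-embeddings of (M, E0) supplied by the hypothesis amalgamate two
of any infinitely many pieces over their bases: there is no infinite antichain.
Hence every piece has an amalgamating extension, i.e. one whose extensions
are pairwise compatible over the base (weak amalgamation).  The expansions in
which every tuple is the base of an amalgamating piece, and which realize over
the base all extensions of their amalgamating pieces, form a comeagre set; by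
back-and-forth they lie in one orbit.  The absence of infinite antichains also
leaves finitely many types of n-tuples in such an expansion, whence
omega-categoricity.
*)

Require Import Defs.
From mathcomp Require Import all_boot finmap.
From mathcomp Require Import all_classical topology.
From Stdlib Require List.

Set Implicit Arguments.
Unset Strict Implicit.
Unset Printing Implicit Defensive.

Local Open Scope classical_set_scope.

(** * Preorders without infinite antichains *)

Section Preorder.
Variables (T : Type) (le : T -> T -> Prop).

Definition compatible (p q : T) : Prop := exists r, le p r /\ le q r.

Definition amalgamating (p : T) : Prop :=
  forall q1 q2, le p q1 -> le p q2 -> compatible q1 q2.

(** Put in terms of sequences: for a reflexive order a repeated element is compatible with itself,
    so a violating sequence lists infinitely many pairwise incompatible elements. *)
Definition no_infinite_antichain : Prop :=
  forall s : nat -> T, exists i j, (i < j)%N /\ compatible (s i) (s j).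

Hypothesis le_refl : forall p, le p p.
Hypothesis le_trans : forall p q r, le p q -> le q r -> le p r.

Lemma amalgamating_le p q : le p q -> amalgamating p -> amalgamating q.
Proof. by move=> pq gp r1 r2 /(le_trans pq) h1 /(le_trans pq) h2; apply: gp. Qed.

(* Otherwise a full binary tree of pairwise incompatible extensions grows above
   [p]; the right children along its leftmost branch form an antichain. *)
Lemma amalgamating_extension p :
  no_infinite_antichain -> exists q, le p q /\ amalgamating q.
Proof.
move=> noanti; apply: contrapT => nogood.
pose bad := {q | le p q}.
have step (x : bad) : exists y : bad * T,
    [/\ le (sval x) (sval y.1), le (sval x) y.2 &
        ~ compatible y.2 (sval y.1)].
  case: x => q pq /=; apply: contrapT => nostep; apply: nogood.
  exists q; split=> // q1 q2 qq1 qq2; apply: contrapT => nc; apply: nostep.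
  by exists (exist _ q2 (le_trans pq qq2), q1).
have [F FP] := choice step.
pose b := fix b k : bad := if k is k'.+1 then (F (b k')).1 else exist _ p (le_refl p).
have mono i j : (i <= j)%N -> le (sval (b i)) (sval (b j)).
  move=> /subnK <-; elim: (j - i) => [|k IH]; first exact: le_refl.
  by apply: le_trans IH _; rewrite addSn /=; case: (FP (b (k + i))).
have [i [j [ij [r [sir sjr]]]]] := noanti (fun k => (F (b k)).2).
have [_ _] := FP (b i); apply; exists r; split=> //.
(* The right child at [j] lies above [b j], hence above [b i.+1], the left sibling of the right
   child at [i]. *)
apply: le_trans sjr; apply: (le_trans (mono i.+1 j ij)).
by case: (FP (b j)).
Qed.

End Preorder.

(** Otherwise one keeps choosing elements to which no earlier choice is related. *)
Lemma finite_representatives (T : Type) (E : T -> T -> Prop) :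
  (forall s : nat -> T, exists i j, (i < j)%N /\ E (s i) (s j)) ->
  exists l : list T, forall t, exists2 u, List.In u l & E u t.
Proof.
move=> ER; apply: contrapT => norep.
have step (l : list T) : exists t, forall u, List.In u l -> ~ E u t.
  apply: contrapT => nt; apply: norep; exists l => t.
  apply: contrapT => nu; apply: nt; exists t => u ul Eut.
  by apply: nu; exists u.
have [F FP] := choice step.
pose l := fix l k : list T := if k is k'.+1 then F (l k') :: l k' else nil.
have inl i j : (i < j)%N -> List.In (F (l i)) (l j).
  elim: j => // j IH; rewrite ltnS leq_eqVlt => /orP[/eqP ->|/IH]; first by left.
  by right.
have [i [j [/inl ij]]] := ER (fun k => F (l k)).
exact: FP.
Qed.

(** * Back-and-forth *)

Lemma countable_code (A : Type) :
  countable [set: A] -> exists c : A -> nat, injective c.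
Proof.
move=> /countable_injP[c cP]; exists c => x y; apply: cP; exact: in_setT.
Qed.

Lemma finite_set_union_chain (A : Type) (V : nat -> set A) (S : set A) :
  (forall i j, (i <= j)%N -> V i `<=` V j) -> (forall a, exists k, V k a) ->
  finite_set S -> exists k, S `<=` V k.
Proof.
move=> mono cover /(@finite_seqP {classic A})[s ->].
elim: s => [|a s [k sk]]; first by exists 0%N.
have [m am] := cover a; exists (maxn m k) => x /=; rewrite inE => /orP[/eqP ->|xs].
  exact: mono (leq_maxl _ _) _ am.
exact: mono (leq_maxr _ _) _ (sk x xs).
Qed.

Lemma finite_set_range (A : Type) (S : set A) :
  finite_set S -> exists n (a : 'I_n -> A), S = range a.
Proof.
move=> /(@finite_seqP {classic A})[s ->].
exists (size s), (tnth (in_tuple s)); apply/seteqP; split=> x /=.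
  by move=> /(@tnthP _ {classic A} (in_tuple s))[i ->]; exists i.
by move=> [i _ <-]; apply: (mem_tnth i (in_tuple s)).
Qed.

Lemma finite_range n (A : Type) (a : 'I_n -> A) : finite_set (range a).
Proof. exact/finite_image/finite_finset. Qed.

Section BackAndForth.
Variables (A B T : Type) (gr : T -> A -> B -> Prop).
Hypotheses (cA : countable [set: A]) (cB : countable [set: B]).
Hypothesis gr_fun : forall t a b b', gr t a b -> gr t a b' -> b = b'.
Hypothesis gr_inj : forall t a a' b, gr t a b -> gr t a' b -> a = a'.
Let ext t t' := forall a b, gr t a b -> gr t' a b.
Hypothesis forth : forall t a, exists t', ext t t' /\ exists b, gr t' a b.
Hypothesis back : forall t b, exists t', ext t t' /\ exists a, gr t' a b.

(** Step [k] puts the elements with code [k] of both sides into the graph, and [f] is the union of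
    the graphs. The last conclusion lets local properties of approximations pass to [f]. *)
Lemma back_and_forth t0 : exists f : A -> B,
  [/\ bijective f, forall a b, gr t0 a b -> f a = b &
      forall S : set A, finite_set S -> exists t, forall a, S a -> gr t a (f a)].
Proof.
have [kA kAI] := countable_code cA; have [kB kBI] := countable_code cB.
have stepA k t : exists t', ext t t' /\ forall a, kA a = k -> exists b, gr t' a b.
  have [[a ak]|na] := pselect (exists a, kA a = k).
    have [t' [tt' ab]] := forth t a; exists t'; split=> // a'.
    by rewrite -ak => /kAI ->.
  by exists t; split=> // a ak; case: na; exists a.
have stepB k t : exists t', ext t t' /\ forall b, kB b = k -> exists a, gr t' a b.
  have [[b bk]|nb] := pselect (exists b, kB b = k).
    have [t' [tt' ab]] := back t b; exists t'; split=> // b'.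
    by rewrite -bk => /kBI ->.
  by exists t; split=> // b bk; case: nb; exists b.
have step (kt : nat * T) : exists t', [/\ ext kt.2 t',
    forall a, kA a = kt.1 -> exists b, gr t' a b &
    forall b, kB b = kt.1 -> exists a, gr t' a b].
  case: kt => k t /=; have [t1 [tt1 t1A]] := stepA k t.
  have [t2 [t12 t2B]] := stepB k t1; exists t2; split=> //.
    by move=> a b /tt1 /t12.
  by move=> a /t1A[b /t12]; exists b.
have [F FP] := choice step.
pose t := fix t k := if k is k'.+1 then F (k', t k') else t0.
have mono i j : (i <= j)%N -> ext (t i) (t j).
  move=> /subnK <-; elim: (j - i) => [//|k IH] a b /IH.
  by rewrite addSn /=; case: (FP (k + i, t (k + i))) => + _ _; apply.
have totA a : exists b k, gr (t k) a b.
  have [_ + _] := FP (kA a, t (kA a)) => /(_ a erefl)[b ab].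
  by exists b, (kA a).+1.
have totB b : exists a k, gr (t k) a b.
  have [_ _] := FP (kB b, t (kB b)) => /(_ b erefl)[a ab].
  by exists a, (kB b).+1.
have [f fP] := choice totA; have [g gP] := choice totB.
have fE k a b : gr (t k) a b -> f a = b.
  move=> ab; have [m fm] := fP a; apply: (@gr_fun (t (maxn k m)) a).
    exact: mono (leq_maxr _ _) _ _ fm.
  exact: mono (leq_maxl _ _) _ _ ab.
have gE k a b : gr (t k) a b -> g b = a.
  move=> ab; have [m gm] := gP b; apply: (@gr_inj (t (maxn k m)) _ _ b).
    exact: mono (leq_maxr _ _) _ _ gm.
  exact: mono (leq_maxl _ _) _ _ ab.
exists f; split.
- exists g => [a|b]; first by have [k /gE] := fP a.
  by have [k /fE] := gP b.
- exact: (fE 0%N).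
- move=> S Sfin.
  have [k Sk] := @finite_set_union_chain A (fun k a => gr (t k) a (f a)) S
    (fun i j ij a => mono i j ij a (f a)) fP Sfin.
  by exists (t k).
Qed.

End BackAndForth.

Lemma comp_scons (A B : Type) (f : A -> B) n x (e : 'I_n -> A) :
  f \o scons x e = scons (f x) (f \o e).
Proof. by apply/funext => i; rewrite /scons /=; case: unlift. Qed.

Lemma scons_eta (A : Type) n (e : 'I_n.+1 -> A) :
  scons (e ord0) (e \o lift ord0) = e.
Proof.
by apply/funext => i; rewrite /scons; case: unliftP => [j ->|->].
Qed.

Lemma no_varsE (A : Type) (e e' : 'I_0 -> A) : e = e'.
Proof. by apply/funext => -[]. Qed.

(** * Back-and-forth between finite tuples *)

Section TupleBackAndForth.
Variables (A B : Type) (P : forall n, ('I_n -> A) -> ('I_n -> B) -> Prop).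
Hypotheses (cA : countable [set: A]) (cB : countable [set: B]).
Hypothesis P_eq : forall n a b, @P n a b -> forall i j, a i = a j <-> b i = b j.
Hypothesis forth : forall n a b, @P n a b -> forall x, exists y, P (scons x a) (scons y b).
Hypothesis back : forall n a b, @P n a b -> forall y, exists x, P (scons x a) (scons y b).

(** An approximation is a pair of tuples in [P], read as the finite map sending [a i] to [b i];
    extending it prepends a point with [scons]. *)
Lemma tuple_back_and_forth n0 (a0 : 'I_n0 -> A) (b0 : 'I_n0 -> B) : P a0 b0 ->
  exists f : A -> B, [/\ bijective f, f \o a0 = b0 &
    forall k (v : 'I_k -> A), exists n (a : 'I_n -> A) (b : 'I_n -> B) (w : 'I_k -> 'I_n),
      [/\ P a b, v = a \o w & f \o v = b \o w]].
Proof.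
move=> P0.
pose T := {n & {ab : ('I_n -> A) * ('I_n -> B) | P ab.1 ab.2}}.
pose gr (t : T) x y := let: existT n (exist ab _) := t in
  exists i, ab.1 i = x /\ ab.2 i = y.
have extT n (a : 'I_n -> A) (b : 'I_n -> B) x y x' y' :
    (exists i, a i = x /\ b i = y) ->
    exists i, scons x' a i = x /\ scons y' b i = y.
  by move=> [i [<- <-]]; exists (lift ord0 i); rewrite /scons liftK.
have newT n (a : 'I_n -> A) (b : 'I_n -> B) x y :
    exists i, scons x a i = x /\ scons y b i = y.
  by exists ord0; rewrite /scons unlift_none.
have [| | | |f [fbij f0 fgr]] := @back_and_forth A B T gr cA cB _ _ _ _
  (existT _ n0 (exist _ (a0, b0) P0)).
- move=> [n [[a b] /= ab]] x y y' [i [<- <-]] [j [aij <-]].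
  exact: (P_eq ab i j).1 (esym aij).
- move=> [n [[a b] /= ab]] x x' y [i [<- <-]] [j [<- bij]].
  exact: (P_eq ab i j).2 (esym bij).
- move=> [n [[a b] /= ab]] x; have [y xyab] := forth ab x.
  exists (existT _ n.+1 (exist _ (scons x a, scons y b) xyab)).
  by split=> [x' y'|]; [exact: extT|exists y; exact: newT].
- move=> [n [[a b] /= ab]] y; have [x xyab] := back ab y.
  exists (existT _ n.+1 (exist _ (scons x a, scons y b) xyab)).
  by split=> [x' y'|]; [exact: extT|exists x; exact: newT].
exists f; split=> //.
  by apply/funext => i; apply: f0; exists i.
move=> k v; have [[n [[a b] ab]] /= tP] := fgr _ (finite_range v).
have /choice[w wP] i : exists j, a j = v i /\ b j = f (v i) by apply: tP; exists i.
exists n, a, b, w; split=> //.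
  by apply/funext => i; case: (wP i).
by apply/funext => i; case: (wP i) => _ /= ->.
Qed.

End TupleBackAndForth.

(** * Types and omega-categoricity *)

Section Satisfaction.
Variable L : language.
Implicit Types A B : structure L.

Definition fexists n (p : formula L n.+1) : formula L n := fneg (fall (fneg p)).

Definition fconj n (l : list (formula L n)) : formula L n :=
  List.fold_right (@fand L n) (ftrue L n) l.

Lemma sat_fand A n (p q : formula L n) (e : 'I_n -> A) :
  sat (fand p q) e <-> sat p e /\ sat q e.
Proof.
split=> /= [h|[hp hq] h]; last exact: h.
by split; apply: contrapT => nh; apply: h => hp hq; apply: nh.
Qed.

Lemma sat_ftrue A n (e : 'I_n -> A) : sat (ftrue L n) e.
Proof. by []. Qed.

Lemma sat_fexists A n (p : formula L n.+1) (e : 'I_n -> A) :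
  sat (fexists p) e <-> exists x, sat p (scons x e).
Proof.
split=> /= [h|[x hx] h]; last exact: (h x).
by apply: contrapT => nh; apply: h => x hx; apply: nh; exists x.
Qed.

Lemma sat_fconj A n (l : list (formula L n)) (e : 'I_n -> A) :
  sat (fconj l) e <-> forall p, List.In p l -> sat p e.
Proof.
elim: l => [|p l IH]; first by split=> // _; apply: sat_ftrue.
rewrite /fconj /= -/(fconj l); split.
  by move=> /sat_fand[hp /IH hl] q [<-|/hl].
by move=> h; apply/sat_fand; split; [apply: h; left|apply/IH => q ql; apply: h; right].
Qed.

Lemma theory_univ_closure A n (p : formula L n) :
  theory A (univ_closure p) <-> forall e : 'I_n -> A, sat p e.
Proof.
elim: n p => [|n IH] p; first by split=> [h e|]; [rewrite (no_varsE e (@no_vars A))|apply].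
apply: (iff_trans (IH (fall p))); split=> [h e|h e x]; last exact: h.
by rewrite -(scons_eta e); apply: h.
Qed.

Lemma sat_isomorphism A B (f : A -> B) : isomorphism f ->
  forall n (p : formula L n) (e : 'I_n -> A), sat p e <-> sat p (f \o e).
Proof.
move=> [[g fK gK] [finj fint]] n p; elim: p => {n} /= [n|n i j|n r v|n p IHp q IHq|n p IH] e.
- by [].
- by split=> [->|/finj].
- exact: fint.
- by rewrite (propext (IHp e)) (propext (IHq e)).
- split=> h x; last by apply/IH; rewrite comp_scons.
  by rewrite -(gK x) -comp_scons; apply/IH.
Qed.

Definition equivalent_tuples A B n (a : 'I_n -> A) (b : 'I_n -> B) : Prop :=
  forall p : formula L n, sat p a <-> sat p b.

Lemma equivalent_tuplesW A B n (a : 'I_n -> A) (b : 'I_n -> B) :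
  (forall p : formula L n, sat p a -> sat p b) -> equivalent_tuples a b.
Proof.
by move=> h p; split=> [|sb]; [exact: h|apply: contrapT => /(h (fneg p)) /=].
Qed.

(** Both cases are merged into one formula so that choice can pick one for each [u]. *)
Lemma separating_formula A n (a u : 'I_n -> A) :
  exists p : formula L n, sat p a /\ (sat p u -> equivalent_tuples a u).
Proof.
have [au|nau] := pselect (equivalent_tuples a u).
  by exists (ftrue L n); split=> //; apply: sat_ftrue.
apply: contrapT => nsep; apply: nau; apply: equivalent_tuplesW => p pa.
by apply: contrapT => npu; apply: nsep; exists p.
Qed.

(** The Ryll-Nardzewski condition for realized types, in a sequence form that matches the hypothesis
    on self-embeddings. *)
Definition finitely_many_types A : Prop :=
  forall n (s : nat -> 'I_n -> A), exists i j, (i < j)%N /\ equivalent_tuples (s i) (s j).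

Definition isolates A n (p : formula L n) : Prop :=
  forall a b : 'I_n -> A, sat p a -> sat p b -> equivalent_tuples a b.

(** Take the conjunction of formulas separating [a] from finitely many representatives of all types:
    a tuple satisfying it has the type of a representative that is not separated from [a]. *)
Lemma isolating_formula A n (a : 'I_n -> A) : finitely_many_types A ->
  exists p : formula L n, sat p a /\ isolates A p.
Proof.
move=> /(_ n)/finite_representatives[l lP].
have [P PP] := choice (@separating_formula A n a).
have key (b : 'I_n -> A) : sat (fconj (List.map P l)) b -> equivalent_tuples a b.
  move=> /sat_fconj sb; have [u ul ub] := lP b.
  have au := (PP u).2 ((ub _).2 (sb _ (List.in_map P l u ul))).
  by move=> q; apply: iff_trans (au q) (ub q).
exists (fconj (List.map P l)); split.
  by apply/sat_fconj => q /List.in_map_iff[u [<- _]]; case: (PP u).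
by move=> b c pb pc q; apply: iff_trans (iff_sym (key b pb q)) (key c pc q).
Qed.

Lemma isolates_complete_formula A n (p : formula L n) (a : 'I_n -> A) :
  sat p a -> isolates A p -> complete_formula A p.
Proof.
move=> pa iso; split; first by move=> /theory_univ_closure h; apply: (h a).
move=> q; have [qa|nqa] := pselect (sat q a); [left|right];
  by apply/theory_univ_closure => b /= pb; have := iso _ _ pa pb q; tauto.
Qed.

End Satisfaction.

(** * Finitely many types imply omega-categoricity *)

Section OmegaCategoricity.
Variables (L : language) (A B : structure L).
Hypotheses (ftA : finitely_many_types A) (mB : models B (theory A)).

Lemma models_transfer n (p : formula L n) :
  (forall e : 'I_n -> A, sat p e) -> forall e : 'I_n -> B, sat p e.
Proof. by move=> h; apply/theory_univ_closure/mB/theory_univ_closure. Qed.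

(** For each [q] true of [a], the implication from [p] to [q] holds throughout [A], hence throughout
    [B]. *)
Lemma isolates_transfer n (p : formula L n) (a : 'I_n -> A) (b : 'I_n -> B) :
  isolates A p -> sat p a -> sat p b -> equivalent_tuples a b.
Proof.
move=> iso pa pb; apply: equivalent_tuplesW => q qa.
by have /(_ b)/(_ pb) := @models_transfer n (fimp p q) (fun a' pa' => (iso a a' pa pa' q).1 qa).
Qed.

Lemma equivalent_forth n (a : 'I_n -> A) (b : 'I_n -> B) (x : A) :
  equivalent_tuples a b -> exists y, equivalent_tuples (scons x a) (scons y b).
Proof.
move=> ab; have [p [pxa iso]] := isolating_formula (scons x a) ftA.
have /ab/sat_fexists[y pyb] : sat (fexists p) a by apply/sat_fexists; exists x.
by exists y; apply: isolates_transfer pyb.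
Qed.

(** [B] realizes no type missing from [A]: that every tuple satisfies one of finitely many isolating
    formulas is expressed by a sentence true in [A]. *)
Lemma equivalent_back n (a : 'I_n -> A) (b : 'I_n -> B) (y : B) :
  equivalent_tuples a b -> exists x, equivalent_tuples (scons x a) (scons y b).
Proof.
move=> ab; have [l lP] := finite_representatives (@ftA n.+1).
have [P PP] := choice (fun u => @isolating_formula L A n.+1 u ftA).
pose none := fconj (List.map (fun u => fneg (P u)) l).
have /models_transfer/(_ (scons y b)) : forall e : 'I_n.+1 -> A, sat (fneg none) e.
  move=> e /sat_fconj he; have [u ul ue] := lP e.
  have /= := he _ (List.in_map (fun u => fneg (P u)) l u ul).
  by apply; apply/ue; case: (PP u).
move=> nnone; have [u pu] : exists u, sat (P u) (scons y b).
  apply: contrapT => nu; apply: nnone; apply/sat_fconj => q /List.in_map_iff[u [<- _]] /= pu.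
  by apply: nu; exists u.
have /ab/sat_fexists[x px] : sat (fexists (P u)) b by apply/sat_fexists; exists y.
by exists x; apply: isolates_transfer px pu; case: (PP u).
Qed.

Lemma finitely_many_types_isomorphic :
  countable [set: A] -> countable [set: B] -> isomorphic A B.
Proof.
move=> cA cB.
have e0 : equivalent_tuples (@no_vars A) (@no_vars B).
  by apply: equivalent_tuplesW => p; apply: mB.
have [n a b ab i j|n a b ab x|n a b ab y|f [fbij _ fP]] :=
  tuple_back_and_forth (P := fun n a b => equivalent_tuples a b) cA cB _ _ _ e0.
- exact: (ab (feq i j)).
- exact: equivalent_forth.
- exact: equivalent_back.
exists f; split=> //; split; first exact: bij_inj.
move=> r v; have [n [a [b [w [ab -> ->]]]]] := fP _ v.
exact: (ab (Defs.frel r w)).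
Qed.

End OmegaCategoricity.

Lemma finitely_many_types_omega_categorical (L : language) (A : structure L) :
  countable [set: A] -> finitely_many_types A -> omega_categorical A.
Proof.
by move=> cA ftA; split=> // B cB mB; apply: finitely_many_types_isomorphic.
Qed.

(** * The space of expansions *)

Lemma sat_lift_formula (L : language) (R : signature) (M : structure L)
    (E : relations R M) n (p : formula L n) (e : 'I_n -> M) :
  @sat _ (expand E) n (lift_formula R p) e <-> sat p e.
Proof.
elim: p e => {n} //= [n p IHp q IHq|n p IH] e.
  by rewrite (propext (IHp e)) (propext (IHq e)).
by split=> h x; [apply/(IH (scons x e))|apply/(IH (scons x e))]; apply: h.
Qed.

Lemma sat_bigand (L : language) (A : structure L) n (I : finType)
    (F : I -> formula L n) (e : 'I_n -> A) :
  sat (\big[@fand L n/@ftrue L n]_(i : I) F i) e <-> forall i, sat (F i) e.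
Proof.
suff h (s : seq I) : sat (\big[@fand L n/@ftrue L n]_(i <- s) F i) e <->
    forall i, i \in s -> sat (F i) e.
  by apply: (iff_trans (h _)); split=> H i => [|_]; apply: H; rewrite ?mem_index_enum.
elim: s => [|i s IH]; first by rewrite big_nil; split=> // _; apply: sat_ftrue.
rewrite big_cons; apply: (iff_trans (sat_fand _ _ _)); rewrite (propext IH).
split=> [[hi hs] j|h]; first by rewrite inE => /orP[/eqP -> //|/hs].
by split=> [|j js]; apply: h; rewrite inE ?eqxx ?js ?orbT.
Qed.

(** * Automorphisms of the Fraïssé limit *)

Section Automorphisms.
Variables (L : language) (M : structure L).
Implicit Types h g : M -> M.

Lemma automorphism_id : automorphism (@id M).
Proof. by split; [exists id|split]. Qed.

Lemma automorphism_comp g h : automorphism g -> automorphism h -> automorphism (g \o h).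
Proof.
move=> [gb [gi gr]] [hb [hi hr]]; split; first exact: bij_comp.
split; first exact: inj_comp.
by move=> r a; apply: iff_trans (hr r a) (gr r (h \o a)).
Qed.

Lemma automorphism_inv h : automorphism h ->
  exists g, [/\ automorphism g, cancel h g & cancel g h].
Proof.
move=> [[g hK gK] [hi hr]]; exists g; split=> //; split; first by exists h.
split; first exact: can_inj gK.
move=> r a; have -> : interp a = interp (h \o (g \o a)).
  by congr (interp _); apply/funext => i /=; rewrite gK.
by apply: iff_sym; apply: hr.
Qed.

(* The automorphism group is closed in the topology of pointwise convergence. *)
Lemma automorphism_limit h : bijective h ->
  (forall S : set M, finite_set S ->
     exists g, automorphism g /\ forall x, S x -> h x = g x) ->
  automorphism h.
Proof.
move=> hb happ; split=> //; split; first exact: bij_inj.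
move=> r a; have [g [[_ [_ gr]] gh]] := happ _ (finite_range a).
have -> : h \o a = g \o a by apply/funext => i; apply: gh; exists i.
exact: gr.
Qed.

Hypothesis uhM : ultrahomogeneous M.

(** Types decide equalities and atomic formulas, so sending [a i] to [b i] is a well-defined partial
    isomorphism, which ultrahomogeneity extends. *)
Lemma equivalent_tuples_automorphism n (a b : 'I_n -> M) :
  equivalent_tuples a b -> exists h, automorphism h /\ h \o a = b.
Proof.
(* [p] is made total; its values off the range of [a] do not matter. *)
move=> ab; have /choice[p pP] x : exists y, forall i, a i = x -> b i = y.
  have [[i <-]|na] := pselect (exists i, a i = x).
    by exists (b i) => j aij; apply/esym/(ab (feq i j)).
  by exists x => i ai; case: na; exists i.
have [|h [haut hp]] := uhM (finite_range a) (p := p).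
  split=> [x y|r v vS].
    rewrite !inE => -[i _ <-] [j _ <-].
    rewrite -(pP _ i erefl) -(pP _ j erefl) => bij.
    exact/(ab (feq i j)).
  have /choice[w wP] i : exists j, a j = v i by have [j _ <-] := vS i; exists j.
  have -> : v = a \o w by apply/funext => i; rewrite /= wP.
  have -> : p \o (a \o w) = b \o w by apply/funext => i /=; rewrite -(pP _ (w i)).
  exact: (ab (Defs.frel r w)).
exists h; split=> //; apply/funext => i /=; rewrite hp; last by exists i.
by rewrite -(pP _ i).
Qed.

End Automorphisms.

(** * Agreement on finite sets, basic formulas and the topology *)

Section Space.
Variables (L : language) (R : signature) (M : structure L).
Local Notation L' := (lang_expand L R).
Implicit Types (E : relations R M) (S : set M) (h : M -> M).

(** For an automorphism [h] of [M] this makes [h] an isomorphism from the expanded substructure on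
    [S] onto the one on its image. *)
Definition agree S h E E' : Prop :=
  forall (r : new_symbol R) (v : 'I_(new_arity r) -> M),
    (forall i, S (v i)) -> (E r v <-> E' r (h \o v)).

Lemma agreeS S S' h E E' : S `<=` S' -> agree S' h E E' -> agree S h E E'.
Proof. by move=> SS' EE' r v vS; apply: EE' => i; apply: SS'. Qed.

Lemma agree_id S E : agree S id E E.
Proof. by []. Qed.

Lemma agree_comp S S' h h' E E' E'' : h @` S `<=` S' ->
  agree S h E E' -> agree S' h' E' E'' -> agree S (h' \o h) E E''.
Proof.
move=> hS EE' EE'' r v vS; apply: iff_trans (EE' r v vS) (EE'' r _ _) => i.
by apply: hS; exists (v i).
Qed.

Lemma agree_inv S h g E E' :
  cancel g h -> agree S h E E' -> agree (g @^-1` S) g E' E.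
Proof.
move=> gK EE' r v vS; apply: iff_sym; apply: iff_trans (EE' r (g \o v) vS) _.
by have -> : h \o (g \o v) = v by apply/funext => i /=; rewrite gK.
Qed.

Lemma eq_agree S h g E E' : {in S, h =1 g} -> agree S h E E' -> agree S g E E'.
Proof.
move=> hg EE' r v vS; have -> : g \o v = h \o v; last exact: EE'.
by apply/funext => i /=; rewrite hg ?inE.
Qed.

Lemma agree_range n (a : 'I_n -> M) h E E' :
  (forall r (w : {ffun 'I_(new_arity r) -> 'I_n}), E r (a \o w) <-> E' r (h \o (a \o w))) ->
  agree (range a) h E E'.
Proof.
move=> H r v va; have /choice[w wP] i : exists j, a j = v i.
  by have [j _ <-] := va i; exists j.
have -> : v = a \o [ffun i => w i] by apply/funext => i; rewrite /= ffunE wP.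
exact: H.
Qed.

Lemma sat_diagram E n d (a : 'I_n -> M) :
  @sat _ (expand E) n (diagram L d) a <->
  forall (r : new_symbol R) (w : {ffun 'I_(new_arity r) -> 'I_n}),
    d r w <-> E r (a \o w).
Proof.
apply: (iff_trans (sat_bigand _ _)); split=> H r.
  move=> w; have /sat_bigand/(_ w) := H r.
  by case: (d r w) => /= Hw; split.
apply/sat_bigand => w; have := H r w.
by case: (d r w) => /= -[H1 H2]; [exact: H1|move=> /H2].
Qed.

Lemma sat_basic_formula E E' n (D : formula L' n) (a : 'I_n -> M) h :
  basic_formula M D -> automorphism h -> agree (range a) h E E' ->
  @sat _ (expand E) n D a -> @sat _ (expand E') n D (h \o a).
Proof.
move=> [d [p [_ ->]]] haut EE' /sat_fand[/sat_diagram dE /sat_lift_formula pa].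
apply/sat_fand; split; last first.
  exact: (sat_lift_formula _ _ _).2 ((sat_isomorphism haut _ _).1 pa).
apply/sat_diagram => r w; apply: (iff_trans (dE r w)).
by apply: (EE' r (a \o w)) => i; exists (w i).
Qed.

Lemma isomorphism_expand E E' h : automorphism h -> agree setT h E E' ->
  @isomorphism _ (expand E) (expand E') h.
Proof.
move=> [hb [hi hr]] EE'; split=> //; split=> // -[r|r] a; first exact: hr.
exact: EE'.
Qed.

Hypotheses (uhM : ultrahomogeneous M) (ftM : finitely_many_types M).

(** [D] joins the diagram of [E] at [a] to a formula isolating the type of [a] in [M]; a realization
    has the type of [a], so ultrahomogeneity supplies [h]. *)
Lemma basic_formula_at E n (a : 'I_n -> M) : exists D : formula L' n,
  [/\ basic_formula M D, @sat _ (expand E) n D a &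
      forall E' b, @sat _ (expand E') n D b ->
        exists h, [/\ automorphism h, h \o a = b & agree (range a) h E E']].
Proof.
have [p [pa iso]] := isolating_formula a ftM.
pose d r (w : {ffun 'I_(new_arity r) -> 'I_n}) := `[< E r (a \o w) >].
have da E' b : @sat _ (expand E') n (diagram L d) b <->
    forall r (w : {ffun 'I_(new_arity r) -> 'I_n}), E r (a \o w) <-> E' r (b \o w).
  apply: (iff_trans (sat_diagram _ _ _)).
  by split=> H r w; [apply: (iff_trans _ (H r w))|apply: (iff_trans _ (H r w))];
    split=> /asboolP.
exists (fand (diagram L d) (lift_formula R p)); split.
- by exists d, p; split=> //; apply: isolates_complete_formula pa iso.
- by apply/sat_fand; split; [apply/da|apply/sat_lift_formula].
- move=> E' b /sat_fand[/da H /sat_lift_formula pb].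
  have [h [haut hab]] := equivalent_tuples_automorphism uhM (iso _ _ pa pb).
  exists h; split=> //; apply: agree_range => r w.
  by have -> : h \o (a \o w) = b \o w by rewrite -hab.
Qed.

Variable E0 : relations R M.

(* The space of expansions is the closure of the orbit of [E0]. *)
Definition orbit_closure E : Prop :=
  forall S, finite_set S -> exists h, automorphism h /\ agree S h E E0.

(** If a finite part of [E] had no copy in [E0], the negation of its basic formula would be an axiom
    false in [E]. Conversely, a basic formula realized in [E] is copied into [E0], so no axiom
    forbids it. *)
Lemma models_basic_theory E :
  models (expand E) (basic_theory E0) <-> orbit_closure E.
Proof.
split=> [mE S Sfin|oE s [[t Mt <-]|[E0s [n [D [bD sD]]]]]].
- have [n [a ->]] := finite_set_range Sfin.
  have [D [bD Da Dagree]] := basic_formula_at E a.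
  apply: contrapT => nh.
  have : basic_theory E0 (univ_closure (fneg D)).
    right; split; last by exists n, D.
    apply/theory_univ_closure => b Db; apply: nh.
    by have [h [? _ ?]] := Dagree E0 b Db; exists h.
  by move=> /mE/theory_univ_closure/(_ a); apply.
- exact/sat_lift_formula.
- rewrite sD; apply/theory_univ_closure => a Da.
  have [h [haut EE0]] := oE _ (finite_range a).
  move: E0s; rewrite sD => /theory_univ_closure/(_ (h \o a)); apply.
  exact: sat_basic_formula Da.
Qed.

Local Notation X := (expansion_space M (basic_theory E0)).

Definition agreement_nbhd (E : X) S : set X := [set E' | agree S id (sval E) (sval E')].

(** The basic clopen sets form a subbase by definition, so an open set yields a finite intersection
    of them, whose finite supports are united. Conversely, the basic formula at an enumeration of
    [S] cuts out a clopen set inside the agreement neighbourhood. *)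
Lemma open_agreement (U : set X) :
  open U <-> forall E : X, U E -> exists S, finite_set S /\ agreement_nbhd E S `<=` U.
Proof.
split=> [[B BI <-] E [V BV VE]|H].
  have [F [FD FV]] : exists F : {fset set X},
      {subset F <= @basic_clopens _ _ M (basic_theory E0)} /\
      \bigcap_(W in [set` F]) W = V :> set X.
    by have [F FD FV] := BI V BV; exists F.
  rewrite -FV in VE.
  have HF (W : set X) : W \in F -> exists S, finite_set S /\ agreement_nbhd E S `<=` W.
    move=> WF; have := FD W WF; rewrite inE => -[n [D [a [bD WE]]]].
    exists (range a); split; first exact: finite_range.
    move=> E' EE'; rewrite WE.
    apply: (sat_basic_formula (h := id) bD (automorphism_id M) EE').
    by have := VE W WF; rewrite WE.
  suff [S [Sfin SV]] : exists S, finite_set S /\ forall W : set X, W \in F -> agreement_nbhd E S `<=` W.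
    exists S; split=> // E' EE'; exists V; first exact: BV.
    have : (\bigcap_(W in [set` F]) W) E' by move=> W WF; apply: SV WF _ EE'.
    by rewrite FV.
  (* Outside [F] the empty support is used, so that choice applies to all [W]. *)
  have HF' (W : set X) : exists S, finite_set S /\ (W \in F -> agreement_nbhd E S `<=` W).
    have [/HF[S [? ?]]|nW] := boolP (W \in F); first by exists S.
    by exists set0; split=> //; exact: finite_set0.
  have [G GP] := choice HF'.
  exists (\bigcup_(W in [set` F]) G W); split.
    by apply: bigcup_finite => [|W _]; [exact: finite_fset|case: (GP W)].
  move=> W WF E' EE'; have [_ /(_ WF)] := GP W; apply.
  by apply: agreeS EE' => x Wx; exists W.
pose I := [set V : set X | basic_clopens V /\ V `<=` U].
have -> : U = \bigcup_(V in I) V.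
  apply/seteqP; split=> [E UE|E [V [_ VU] /VU //]].
  have [S [Sfin SU]] := H E UE; have [n [a Sa]] := finite_set_range Sfin.
  have [D [bD Da Dagree]] := basic_formula_at (sval E) a.
  exists (@basic_clopen _ _ _ _ n D a) => //; split; first by exists n, D, a.
  (* Here [h] fixes [a] pointwise, so agreement along [h] on [S] is agreement along the identity. *)
  move=> E' /Dagree[h [_ ha EE']]; apply: SU; rewrite Sa /agreement_nbhd /=.
  apply: eq_agree EE' => x; rewrite inE => -[i _ <-].
  by rewrite -[in RHS]ha.
apply: bigcup_open => V [bV _].
exists [set V]; last by rewrite bigcup_set1.
move=> _ ->; exact: finI_from1.
Qed.

End Space.

(** * Comeagre sets *)

Section Comeagre.
Variable X : topologicalType.
Implicit Types A B : set X.

Lemma comeagre_open_dense A : open A -> dense A -> comeagre A.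
Proof. by move=> oA dA; exists (fun=> A); split=> // x /(_ 0%N I). Qed.

Lemma comeagreT : comeagre [set: X].
Proof.
by apply: comeagre_open_dense; [exact: openT|move=> O [x Ox] _; exists x].
Qed.

Lemma comeagreS A B : A `<=` B -> comeagre A -> comeagre B.
Proof. by move=> AB [U [Uod UA]]; exists U; split=> // x /UA /AB. Qed.

Lemma comeagre_bigcap (A : nat -> set X) :
  (forall k, comeagre (A k)) -> comeagre (\bigcap_k A k).
Proof.
move=> /choice[U UP].
(* The double family [U k i] in one sequence; numbers coding no pair give the whole space. *)
pose V m := if choice.unpickle m is Some (k, i) then U k i else setT.
exists V; split=> [m|x Vx k _].
  rewrite /V; case: choice.unpickle => [[k i]|]; first by have [+ _] := UP k; apply.
  split; first exact: openT.
  by move=> O [x Ox] _; exists x.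
have [_] := UP k; apply=> i _.
by have := Vx (choice.pickle (k, i)) I; rewrite /V choice.pickleK.
Qed.

Lemma comeagre_forall (J : Type) (A : J -> X -> Prop) : countable [set: J] ->
  (forall j, comeagre [set x | A j x]) -> comeagre [set x | forall j, A j x].
Proof.
move=> /countable_code[c cI] Acom.
apply: (@comeagreS (\bigcap_k [set x | forall j, c j = k -> A j x])).
  by move=> x Ax j; apply: (Ax (c j) I).
apply: comeagre_bigcap => k.
have [[j <-]|nj] := pselect (exists j, c j = k).
  by apply: comeagreS (Acom j) => x /= Ax i /cI ->.
by apply: comeagreS comeagreT => x _ j jk; case: nj; exists j.
Qed.

Lemma comeagreI A B : comeagre A -> comeagre B -> comeagre (A `&` B).
Proof.
move=> cA cB; apply: (@comeagreS [set x | forall b : bool, (if b then A else B) x]).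
  by move=> x AB; split; [exact: (AB true)|exact: (AB false)].
by apply: comeagre_forall => [|[]]; first exact: countableP.
Qed.

End Comeagre.

Lemma countable_tuples (A : Type) n : countable [set: A] -> countable [set: 'I_n -> A].
Proof.
move=> /countable_code[c cI]; apply/countable_injP.
exists (fun a => choice.pickle [ffun i => c (a i)]) => a b _ _ /(pcan_inj choice.pickleK)/ffunP ab.
by apply/funext => i; apply: cI; have := ab i; rewrite !ffunE.
Qed.

(** * Finite pieces and weak genericity *)

Section Pieces.
Variables (L : language) (R : signature) (M : structure L) (E0 : relations R M).
Implicit Types (E : relations R M) (S : set M) (h : M -> M).

(** A piece keeps an ambient expansion on all of [M], which serves as a point of the space;
    [piece_le] only looks at relations on the supports. *)
Record piece n := Piece {
  rels : relations R M;
  base : 'I_n -> M;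
  supp : set M;
  rels_closure : orbit_closure E0 rels;
  supp_finite : finite_set supp;
  base_supp : range base `<=` supp }.

Lemma piece_eq n (p q : piece n) :
  rels p = rels q -> base p = base q -> supp p = supp q -> p = q.
Proof.
case: p q => [E u S oE fS uS] [E' u' S' oE' fS' uS'] /= EE' uu' SS'.
move: oE' fS' uS'; rewrite -EE' -uu' -SS' => oE' fS' uS'.
by congr Piece; apply: Prop_irrelevance.
Qed.

Definition piece_le n (p q : piece n) : Prop :=
  exists h, [/\ automorphism h, agree (supp p) h (rels p) (rels q),
                h \o base p = base q & h @` supp p `<=` supp q].

Lemma piece_le_refl n (p : piece n) : piece_le p p.
Proof.
by exists id; split=> //; [exact: automorphism_id|move=> _ [x px <-]].
Qed.

Lemma piece_le_trans n (p q r : piece n) :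
  piece_le p q -> piece_le q r -> piece_le p r.
Proof.
move=> [h [ha hE hb hS]] [g [ga gE gb gS]]; exists (g \o h); split.
- exact: automorphism_comp.
- exact: agree_comp hS hE gE.
- by rewrite -gb -hb.
- by move=> _ [x px <-]; apply: gS; exists (h x) => //; apply: hS; exists x.
Qed.

(** For an automorphism [h], the expansion that [h] maps isomorphically onto [E]. *)
Definition pullback h E : relations R M := fun r v => E r (h \o v).

Lemma orbit_closure_pullback h E :
  automorphism h -> orbit_closure E0 E -> orbit_closure E0 (pullback h E).
Proof.
move=> ha oE S Sfin; have [k [ka kE]] := oE (h @` S) (finite_image h Sfin).
exists (k \o h); split; first exact: automorphism_comp.
exact: (agree_comp (fun=> id) (h := h) (E' := E)) kE.
Qed.

Lemma orbit_closure_self : orbit_closure E0 E0.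
Proof. by move=> S _; exists id; split=> //; exact: automorphism_id. Qed.

Section Move.
Variables (n : nat) (p : piece n) (h : M -> M) (E : relations R M).
Hypothesis oE : orbit_closure E0 E.

Lemma move_base_supp : range (h \o base p) `<=` h @` supp p.
Proof. by move=> _ [i _ <-]; exists (base p i) => //; apply: base_supp; exists i. Qed.

(** The image of [p] under [h] with the relations of [E]; it is a copy of [p] once [h] is an
    automorphism agreeing with both expansions on the support. *)
Definition move_piece : piece n :=
  Piece oE (finite_image h (supp_finite p)) move_base_supp.

Hypotheses (ha : automorphism h) (hE : agree (supp p) h (rels p) E).

Lemma le_move_piece : piece_le p move_piece.
Proof. by exists h; split. Qed.

Lemma move_piece_le : piece_le move_piece p.
Proof.
have [g [ga hK gK]] := automorphism_inv ha; exists g; split=> //=.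
- apply: agreeS (agree_inv gK hE) => _ [x px <-].
  by rewrite /preimage /= hK.
- by apply/funext => i /=; rewrite hK.
- by move=> _ [_ [x px <-] <-]; rewrite hK.
Qed.

End Move.

Lemma piece_model n (p : piece n) :
  exists q, [/\ rels q = E0, piece_le p q & piece_le q p].
Proof.
have [h [ha hE]] := rels_closure p (supp_finite p).
exists (move_piece p h orbit_closure_self); split=> //.
  exact: le_move_piece.
exact: move_piece_le.
Qed.

(** Neighbourhoods speak of agreement along the identity, so the extension is conjugated back until
    it literally contains [p]. *)
Lemma piece_le_pullback n (p q : piece n) : piece_le p q ->
  exists q', [/\ piece_le q q', base q' = base p, supp p `<=` supp q' &
                 agree (supp p) id (rels p) (rels q')].
Proof.
move=> [h [ha hE hb hS]]; have [g [ga hK gK]] := automorphism_inv ha.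
have oq := orbit_closure_pullback ha (rels_closure q).
exists (move_piece q g oq); split=> //=.
- apply: le_move_piece => // r v _; rewrite /pullback.
  by have -> : h \o (g \o v) = v by apply/funext => i /=; rewrite gK.
- by rewrite -hb; apply/funext => i /=; rewrite hK.
- by move=> x px; exists (h x); [apply: hS; exists x|rewrite hK].
Qed.

Local Notation amalg := (amalgamating (@piece_le _)).

Lemma range_finite_setU n (x : 'I_n -> M) S : finite_set S ->
  finite_set (range x `|` S).
Proof. by move=> Sfin; rewrite finite_setU; split=> //; exact: finite_range. Qed.

Lemma subset_piece n (p : piece n) S : finite_set S ->
  exists q, [/\ rels q = rels p, base q = base p, S `<=` supp q & piece_le p q].
Proof.
move=> Sfin; have qfin : finite_set (supp p `|` S).
  by rewrite finite_setU; split=> //; exact: supp_finite.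
have qsupp : range (base p) `<=` supp p `|` S by move=> x /base_supp; left.
exists (Piece (rels_closure p) qfin qsupp); split=> //=.
exists id; split=> //=; first exact: automorphism_id.
by move=> _ [x px <-]; left.
Qed.

(** * Weakly generic expansions and the back-and-forth between them *)

Definition realizes_amalgamating E : Prop :=
  forall n (x : 'I_n -> M), exists p : piece n, [/\ rels p = E, base p = x & amalg p].

(** Only the base stays fixed; the rest of the support of [p] may move. This is what weak, rather
    than full, amalgamation affords. *)
Definition realizes_extensions E : Prop :=
  forall n (p q : piece n), rels p = E -> amalg p -> piece_le p q ->
  exists p' : piece n, [/\ rels p' = E, base p' = base p & piece_le q p'].

Definition weakly_generic E : Prop := realizes_amalgamating E /\ realizes_extensions E.

(** The back-and-forth relation: the tuples are bases of compatible amalgamating pieces. *)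
Definition linked E E' n (c c' : 'I_n -> M) : Prop :=
  exists p p' : piece n,
    [/\ rels p = E, base p = c & amalg p] /\
    [/\ rels p' = E', base p' = c', amalg p' & compatible (@piece_le n) p p'].

Lemma linked_sym E E' n (c c' : 'I_n -> M) : linked E E' c c' -> linked E' E c' c.
Proof.
move=> [p [p' [[? ? ?] [? ? ? [r [pr p'r]]]]]].
by exists p', p; split; split=> //; exists r.
Qed.

(** Embeddings [k], [k'] of the two pieces into a common extension send both bases to the same
    tuple; compose [k] with the inverse of [k']. *)
Lemma linked_agree E E' n (c c' : 'I_n -> M) : linked E E' c c' ->
  exists h, [/\ automorphism h, h \o c = c' & agree (range c) h E E'].
Proof.
move=> [p [p' [[<- <- _] [<- <- _ [r [[k [ka kE kb _]] [k' [k'a k'E k'b _]]]]]]]].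
have [g [ga k'K gK]] := automorphism_inv k'a.
have hb : (g \o k) \o base p = base p'.
  by apply/funext => i; have := congr1 (@^~ i) (etrans kb (esym k'b)) => /= ->; rewrite k'K.
exists (g \o k); split=> //; first exact: automorphism_comp.
apply: agree_range => s w.
have -> : (g \o k) \o (base p \o w) = base p' \o w by rewrite -hb.
apply: (iff_trans (kE s (base p \o w) _)).
  by move=> i; apply: base_supp; exists (w i).
apply: iff_sym; apply: (iff_trans (k'E s (base p' \o w) _)).
  by move=> i; apply: base_supp; exists (w i).
have -> // : k' \o (base p' \o w) = k \o (base p \o w).
by rewrite -[k \o (_ \o w)]/((k \o base p) \o w) kb -k'b.
Qed.

(* An amalgamating piece over [scons m c] is, over [c], an extension of the
   piece linking [c] to [c'], so it is also realized in [E'] over [c']. *)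
Lemma linked_forth E E' n (c c' : 'I_n -> M) m :
  weakly_generic E -> weakly_generic E' ->
  linked E E' c c' -> exists m', linked E E' (scons m c) (scons m' c').
Proof.
move=> [WE _] [_ WE'] [p [p' [[pE pc pa] [p'E p'c p'a [r [pr p'r]]]]]].
have [t [tE tb ta]] := WE n.+1 (scons m c).
have [p1 [p1E p1b p1S pp1]] := subset_piece p (supp_finite t).
(* Both [p1], which contains the support of [t], and [r], which lies above [p'], extend the
   amalgamating [p]. So [r2] extends [p'] too and is realized in [E'] over [c']. *)
have [r2 [p1r2 rr2]] := pa _ _ pp1 pr.
have [q [qE qb r2q]] := WE' n p' r2 p'E p'a (piece_le_trans p'r rr2).
have [h [ha hE hb hS]] := piece_le_trans p1r2 r2q.
have hE' : agree (supp t) h (rels t) (rels q).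
  by rewrite tE -pE -p1E; apply: agreeS hE.
pose t' := move_piece t h (rels_closure q).
have tt' : piece_le t t' by apply: le_move_piece.
(* The copy [t'] of [t] in [E'] witnesses the new link, being itself a common extension. *)
exists (h m), t, t'; split=> //; split.
- by rewrite /= qE.
- by rewrite /= tb comp_scons -pc -p1b hb qb p'c.
- exact: (amalgamating_le (@piece_le_trans n.+1) tt' ta).
- by exists t'; split=> //; apply: piece_le_refl.
Qed.

(** The bijection built by back-and-forth coincides on each finite set with an automorphism from
    [linked_agree]; being an automorphism and carrying [E] to [E'] are checked on finite tuples. *)
Lemma linked_automorphism E E' n (c c' : 'I_n -> M) : countable [set: M] ->
  weakly_generic E -> weakly_generic E' -> linked E E' c c' ->
  exists h, [/\ automorphism h, h \o c = c' & agree setT h E E'].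
Proof.
move=> cM wE wE' lcc'.
have [k a b|k a b ab x|k a b ab y|f [fbij fc fP]] :=
  tuple_back_and_forth (P := linked E E') cM cM _ _ _ lcc'.
- move=> /linked_agree[h [[_ [hi _]] <- _]] i j /=.
  by split=> [->|/hi].
- exact: linked_forth.
(* The back step is the forth step with the two expansions exchanged. *)
- have [x /linked_sym] := linked_forth y wE' wE (linked_sym ab); by exists x.
exists f; split=> //.
  apply: automorphism_limit => // S /finite_set_range[k [v ->]].
  have [l [a [b [w [/linked_agree[h [ha hab _]] vE fv]]]]] := fP _ v.
  exists h; split=> // _ [i _ <-].
  by have := congr1 (@^~ i) fv => /= ->; rewrite vE /= -hab.
move=> r v _; have [l [a [b [w [/linked_agree[h [ha hab hE]] vE fv]]]]] := fP _ v.
have -> : f \o v = h \o v by rewrite fv vE -hab.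
by apply: hE => i; rewrite vE; exists (w i).
Qed.

(** * Consequences of the self-embedding hypothesis *)

Section SelfEmbeddings.
Hypothesis uhM : ultrahomogeneous M.
Hypothesis selfembedding : forall n (a : nat -> 'I_n -> M), exists i j f,
  [/\ (i < j)%N, elementary f, agree setT f E0 E0 & f \o a i = a j].

Lemma elementary_finitely_many_types : finitely_many_types M.
Proof.
move=> n s; have [i [j [f [ij fe _ fij]]]] := selfembedding s.
by exists i, j; split=> // p; rewrite -fij; apply: fe.
Qed.

(** Move all pieces into [E0] and let a self-embedding [f] carry one base to a later one. Within
    [E0], the image of the first support together with the second support is a common extension. *)
Lemma piece_no_infinite_antichain n : no_infinite_antichain (@piece_le n).
Proof.
move=> s; have /choice[q qP] k := piece_model (s k).
have [i [j [f [ij fe fE fb]]]] := selfembedding (fun k => base (q k)).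
have [qiE si _] := qP i; have [qjE sj _] := qP j.
have [m [v vS]] := finite_set_range (supp_finite (q i)).
(* [f] may fail to be surjective, while [piece_le] asks for an automorphism; elementarity gives one
   equal to [f] on the finite support. *)
have [h [ha hv]] := equivalent_tuples_automorphism uhM (fun p => fe _ p v).
have hf x : supp (q i) x -> h x = f x.
  by rewrite vS => -[l _ <-]; have := congr1 (@^~ l) hv.
have [r [rE rb rS jr]] := subset_piece (q j) (finite_image f (supp_finite (q i))).
exists i, j; split=> //; exists r; split; last exact: piece_le_trans sj jr.
apply: (piece_le_trans si); exists h; split=> //.
- rewrite rE qiE qjE; apply: (@eq_agree _ _ _ _ f).
    by move=> x; rewrite inE => /hf.
  exact: agreeS fE.
- rewrite rb -fb; apply/funext => l /=; apply: hf; apply: base_supp.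
  by exists l.
- by move=> _ [x qx <-]; apply: rS; exists x => //; rewrite hf.
Qed.

(** With an empty base, joint embedding suffices: both pieces have copies in [E0], and the union of
    their supports extends both. *)
Lemma linked_no_vars E E' : weakly_generic E -> weakly_generic E' ->
  linked E E' (@no_vars M) (@no_vars M).
Proof.
move=> [/(_ 0%N (@no_vars M))[p [pE pb pa]] _] [/(_ 0%N (@no_vars M))[p' [p'E p'b p'a]] _].
exists p, p'; split; split=> //.
have [q [qE pq _]] := piece_model p; have [q' [q'E p'q' _]] := piece_model p'.
have [r [rE rb rS qr]] := subset_piece q (supp_finite q').
exists r; split; first exact: piece_le_trans qr.
apply: piece_le_trans p'q' _; exists id; split=> //.
- exact: automorphism_id.
- by rewrite rE qE q'E.
- exact: no_varsE.
- by move=> _ [x q'x <-]; apply: rS.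
Qed.

(** Among amalgamating pieces over the tuples of a sequence two are compatible, so their bases are
    linked and conjugate under an automorphism of the expansion. *)
Lemma weakly_generic_finitely_many_types E : countable [set: M] ->
  weakly_generic E -> finitely_many_types (expand E).
Proof.
move=> cM wE n s.
have /choice[p pP] k : exists p : piece n, [/\ rels p = E, base p = s k & amalg p].
  by case: wE => + _; apply.
have [i [j [ij pij]]] := piece_no_infinite_antichain p.
have lij : linked E E (s i) (s j).
  have [? ? ?] := pP i; have [? ? ?] := pP j.
  by exists (p i), (p j); split; split.
have [h [ha hij hE]] := linked_automorphism cM wE wE lij.
exists i, j; split=> // q; rewrite -hij.
exact: (sat_isomorphism (isomorphism_expand ha hE)).
Qed.

End SelfEmbeddings.

End Pieces.

(** * Genericity *)

Section Genericity.
Variables (L : language) (R : signature) (M : structure L) (E0 : relations R M).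
Hypotheses (cM : countable [set: M]) (uhM : ultrahomogeneous M).
Hypothesis selfembedding : forall n (a : nat -> 'I_n -> M), exists i j f,
  [/\ (i < j)%N, elementary f, agree setT f E0 E0 & f \o a i = a j].

Local Notation X := (expansion_space M (basic_theory E0)).
Local Notation amalg := (amalgamating (@piece_le _ _ _ _ _)).

Let ftM : finitely_many_types M := elementary_finitely_many_types selfembedding.

Lemma space_closure (E : X) : orbit_closure E0 (sval E).
Proof. exact/(models_basic_theory uhM ftM)/(svalP E). Qed.

Definition space_point (E : relations R M) (oE : orbit_closure E0 E) : X :=
  exist _ E ((models_basic_theory uhM ftM E0 E).2 oE).

Lemma comeagre_agreement (U : set X) :
  (forall E, U E -> exists S, finite_set S /\ agreement_nbhd E S `<=` U) ->
  (forall (E : X) S, finite_set S -> exists E', agreement_nbhd E S E' /\ U E') ->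
  comeagre U.
Proof.
move=> Uopen Udense; apply: comeagre_open_dense; first exact/(open_agreement uhM ftM).
move=> O [E OE] /(open_agreement uhM ftM)/(_ E OE)[S [Sfin SO]].
by have [E' [/SO OE' UE']] := Udense E S Sfin; exists E'.
Qed.

(** For a fixed tuple the condition is open, as a witness has finite support. It is dense, since the
    piece on [range x] and [S] extends to an amalgamating one, pulled back so that [S] is
    unchanged. *)
Lemma comeagre_realizes_amalgamating :
  comeagre [set E : X | realizes_amalgamating E0 (sval E)].
Proof.
apply: (comeagre_forall (countableP _)) => n.
apply: (comeagre_forall (countable_tuples n cM)) => x.
apply: comeagre_agreement => [E [p [pE px pa]]|E S Sfin].
  exists (supp p); split; first exact: supp_finite.
  move=> E' EE'; have pp' : piece_le p (move_piece p id (space_closure E')).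
    by apply: le_move_piece; [exact: automorphism_id|rewrite pE].
  exists (move_piece p id (space_closure E')); split=> //.
  exact: (amalgamating_le (@piece_le_trans _ _ _ _ n) pp' pa).
have pS : range x `<=` range x `|` S by left.
pose p := Piece (space_closure E) (range_finite_setU x Sfin) pS.
have [q [pq qa]] := amalgamating_extension (@piece_le_refl _ _ _ E0 n)
  (@piece_le_trans _ _ _ E0 n) p (piece_no_infinite_antichain uhM selfembedding (n := n)).
have [q' [qq' q'x _ pq']] := piece_le_pullback pq.
exists (space_point (rels_closure q')); split.
  by apply: agreeS pq' => y Sy; right.
by exists q'; split=> //; exact: (amalgamating_le (@piece_le_trans _ _ _ _ n) qq' qa).
Qed.

Lemma comeagre_realizes_extension n (x : 'I_n -> M) S (q : piece E0 n) :
  comeagre [set E : X | forall p : piece E0 n,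
    rels p = sval E -> base p = x -> supp p = S -> amalg p -> piece_le p q ->
    exists p' : piece E0 n, [/\ rels p' = sval E, base p' = x & piece_le q p']].
Proof.
apply: comeagre_agreement => E.
- move=> HE; have [[p [pE px pS pa pq]]|np] := pselect (exists p : piece E0 n,
      [/\ rels p = sval E, base p = x, supp p = S, amalg p & piece_le p q]).
    have [p' [p'E p'x qp']] := HE p pE px pS pa pq.
    exists (supp p'); split; first exact: supp_finite.
    move=> E' EE' _ _ _ _ _ _; exists (move_piece p' id (space_closure E')).
    split=> //; apply: piece_le_trans qp' _.
    by apply: le_move_piece; [exact: automorphism_id|rewrite p'E].
  have [Sfin|nSfin] := pselect (finite_set S); last first.
    exists set0; split; first exact: finite_set0.
    by move=> E' _ p _ _ pS; case: nSfin; rewrite -pS; exact: supp_finite.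
  (* The condition is vacuous at [E] and stays so nearby: a piece [p] in [E'] supported on [S] would
     also occur in [E]. *)
  exists S; split=> // E' EE' p pE' px pS pa pq; case: np.
  have pE : agree (supp p) id (rels p) (sval E).
    by rewrite pS pE' => r v vS; apply: iff_sym; apply: EE'.
  pose p1 := move_piece p id (space_closure E).
  have pp1 : piece_le p p1 by apply: le_move_piece => //; exact: automorphism_id.
  have p1p : piece_le p1 p by apply: move_piece_le => //; exact: automorphism_id.
  exists p1; split=> //=.
  + by rewrite image_id.
  + exact: (amalgamating_le (@piece_le_trans _ _ _ _ n) pp1 pa).
  + exact: piece_le_trans p1p pq.
- move=> S' S'fin; have [[p [pE px pS pa pq]]|np] := pselect (exists p : piece E0 n,
      [/\ rels p = sval E, base p = x, supp p = S, amalg p & piece_le p q]).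
    have [p1 [p1E p1x p1S pp1]] := subset_piece p S'fin.
    (* Density: since [p] is amalgamating, [q] can be realized above [p1], hence without changing
       [E] on [S']. *)
    have [r [p1r qr]] := pa _ _ pp1 pq.
    have [q' [rq' q'x p1q' p1E']] := piece_le_pullback p1r.
    exists (space_point (rels_closure q')); split.
      by rewrite /agreement_nbhd /= -pE -p1E; apply: agreeS p1E'.
    move=> _ _ _ _ _ _; exists q'; split=> //; first by rewrite q'x p1x.
    exact: piece_le_trans rq'.
  exists E; split; first exact: agree_id.
  by move=> p pE px pS pa pq; case: np; exists p.
Qed.

(** Countably many conditions suffice: [q] is replaced by an equivalent piece of [E0], given by
    finite tuples for base and support, and [p] enters only through its base and support. *)
Lemma comeagre_realizes_extensions :
  comeagre [set E : X | realizes_extensions E0 (sval E)].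
Proof.
pose A n (x : 'I_n -> M) k (s : 'I_k -> M) (u : 'I_n -> M) l (w : 'I_l -> M) (E : X) :=
  forall p q : piece E0 n,
    rels q = E0 -> base q = u -> supp q = range w ->
    rels p = sval E -> base p = x -> supp p = range s -> amalg p -> piece_le p q ->
    exists p' : piece E0 n, [/\ rels p' = sval E, base p' = x & piece_le q p'].
apply: (@comeagreS _ [set E | forall n x k s u l w, @A n x k s u l w E]).
  move=> E AE n p q pE pa pq.
  have [q0 [q0E qq0 q0q]] := piece_model q.
  have [k [s pS]] := finite_set_range (supp_finite p).
  have [l [w q0S]] := finite_set_range (supp_finite q0).
  have [p' [p'E p'x q0p']] := AE n _ k s _ l w p q0 q0E erefl q0S pE erefl pS pa
    (piece_le_trans pq qq0).
  by exists p'; split=> //; apply: piece_le_trans q0p'.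
apply: (comeagre_forall (countableP _)) => n.
apply: (comeagre_forall (countable_tuples n cM)) => x.
apply: (comeagre_forall (countableP _)) => k.
apply: (comeagre_forall (countable_tuples k cM)) => s.
apply: (comeagre_forall (countable_tuples n cM)) => u.
apply: (comeagre_forall (countableP _)) => l.
apply: (comeagre_forall (countable_tuples l cM)) => w.
(* By [piece_eq] at most one piece has these data; if none has, the condition is vacuous. *)
have [[q [qE qu qS]]|nq] := pselect (exists q : piece E0 n,
    [/\ rels q = E0, base q = u & supp q = range w]).
  apply: comeagreS (comeagre_realizes_extension x (range s) q) => E /= HE p q1 q1E q1u q1S.
  have -> : q1 = q by apply: piece_eq; [rewrite qE|rewrite qu|rewrite qS].
  exact: HE.
apply: comeagreS (comeagreT X) => E _ p q qE qu qS.
by case: nq; exists q.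
Qed.

Lemma comeagre_weakly_generic : comeagre [set E : X | weakly_generic E0 (sval E)].
Proof.
exact: (comeagreI comeagre_realizes_amalgamating comeagre_realizes_extensions).
Qed.

(** The Baire category argument: shrinking agreement neighbourhoods enter the dense open sets one by
    one, and their growing finite supports determine a limit expansion. *)
Lemma space_baire (A : set X) : comeagre A -> A !=set0.
Proof.
move=> [U [Uod UA]]; have [c cI] := countable_code cM.
(* Each fiber has at most one point; adding the [k]-th at stage [k] makes the supports exhaust
   [M]. *)
pose code_fiber k := [set m : M | c m = k].
have fiber_fin k : finite_set (code_fiber k).
  have [[m <-]|nm] := pselect (exists m, c m = k).
    by apply: (@sub_finite_set _ _ [set m]) => [m' /cI|//].
  by apply: (@sub_finite_set _ _ set0) => [m mk|//]; case: nm; exists m.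
pose T := {t : X * set M | finite_set t.2}.
have step (kt : nat * T) : exists t' : T,
    [/\ agreement_nbhd (sval kt.2).1 (sval kt.2).2 (sval t').1,
        (sval kt.2).2 `<=` (sval t').2, code_fiber kt.1 `<=` (sval t').2 &
        agreement_nbhd (sval t').1 (sval t').2 `<=` U kt.1].
  case: kt => k [[E S] /= Sfin]; have [Uo Ud] := Uod k.
  have [||E' [EE' UE']] := Ud (agreement_nbhd E S).
  - by exists E; exact: agree_id.
  - apply/(open_agreement uhM ftM) => E' EE'; exists S; split=> // E'' E'E'' r v vS.
    exact: iff_trans (EE' r v vS) (E'E'' r v vS).
  have [S' [S'fin S'U]] := (@open_agreement _ _ _ uhM ftM _ _).1 Uo E' UE'.
  have fin : finite_set (S `|` code_fiber k `|` S').
    by rewrite !finite_setU.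
  exists (exist _ (E', S `|` code_fiber k `|` S') fin); split=> //=.
  - by move=> x Sx; left; left.
  - by move=> x kx; left; right.
  - by move=> E'' E'E''; apply: S'U; apply: agreeS E'E'' => x; right.
have [F FP] := choice step.
pose t0 : T := exist _ (space_point (@orbit_closure_self _ _ _ E0), set0) (finite_set0 M).
pose t := fix t k : T := if k is k'.+1 then F (k', t k') else t0.
pose E k := sval (sval (t k)).1; pose S k := (sval (t k)).2.
have mono i j : (i <= j)%N -> S i `<=` S j /\ agree (S i) id (E i) (E j).
  move=> /subnK <-; elim: (j - i) => [|k [IHS IHE]]; first by split; last exact: agree_id.
  rewrite addSn.
  have [h1 h2 _ _] := FP ((k + i)%N, t (k + i)%N); split=> [x /IHS /h2 //|].
  move=> r v vS; apply: iff_trans (IHE r v vS) _.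
  by apply: (h1 r v) => l; apply: IHS.
(* Eventual truth; on [S k] the value is settled from stage [k] on. *)
pose Elim : relations R M := fun r v => exists k, forall j, (k <= j)%N -> E j r v.
have ElimE k : agree (S k) id Elim (E k).
  move=> r v vS; split=> [[m mE]|kE].
    have [_ kmE] := mono k (maxn k m) (leq_maxl _ _).
    by apply/(kmE r v vS); apply: mE; exact: leq_maxr.
  by exists k => j kj; have [_ kjE] := mono k j kj; apply/(kjE r v vS).
have oElim : orbit_closure E0 Elim.
  move=> V Vfin; have [k Vk] : exists k, V `<=` S k.
    apply: finite_set_union_chain Vfin => [i j /mono[]//|m].
    exists (c m).+1; have [_ _ + _] := FP (c m, t (c m)).
    by apply.
  have [h [ha hE]] := space_closure (sval (t k)).1 Vfin.
  exists h; split=> // r v vV; apply: iff_trans (ElimE k r v _) (hE r v vV) => i.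
  exact: Vk.
exists (space_point oElim); apply: UA => k _.
have [_ _ _] := FP (k, t k); apply=> r v vS.
apply: iff_sym; exact: (ElimE k.+1 r v vS).
Qed.

(** All weakly generic expansions lie in one orbit, which therefore contains a comeagre set. *)
Lemma weakly_generic_generic (G : X) : weakly_generic E0 (sval G) -> generic G.
Proof.
move=> wG; apply: comeagreS comeagre_weakly_generic => E wE.
have [h [ha _ hE]] := linked_automorphism cM wG wE (linked_no_vars wG wE).
by exists h; split=> // r a; apply: hE.
Qed.

(** By Baire category a comeagre orbit meets the weakly generic expansions, so [G] is isomorphic to
    one of them. *)
Lemma generic_finitely_many_types (G : X) :
  generic G -> finitely_many_types (expand (sval G)).
Proof.
move=> gG; have [E [[g [ga gE]] wE]] := space_baire (comeagreI gG comeagre_weakly_generic).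
have giso : @isomorphism _ (expand (sval G)) (expand (sval E)) g.
  by apply: isomorphism_expand => // r v _; apply: gE.
move=> n s.
have [i [j [ij sij]]] := weakly_generic_finitely_many_types uhM selfembedding cM wE
  (fun k => g \o s k).
exists i, j; split=> // p; apply: iff_trans (sat_isomorphism giso _ _) _.
apply: iff_trans (sij p) _; apply: iff_sym; exact: sat_isomorphism.
Qed.

Lemma self_embeddings_omega_categorical_generic :
  has_omega_categorical_generic M (basic_theory E0).
Proof.
split; last first.
  move=> G /generic_finitely_many_types; exact: finitely_many_types_omega_categorical.
have [G wG] := space_baire comeagre_weakly_generic.
by exists G; apply: weakly_generic_generic.
Qed.

End Genericity.

(** * Application to linear orders and AZ-enumerations *)

Lemma elementary_embedding (L : language) (A B : structure L) (f : A -> B) :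
  elementary f -> embedding f.
Proof.
move=> fe; split=> [x y fxy|r a]; last exact: (fe _ (Defs.frel r id) a).
pose e := scons x (scons y (@no_vars A)).
have [ex ey] : e ord0 = x /\ e (lift ord0 ord0) = y.
  by rewrite /e /scons unlift_none liftK unlift_none.
rewrite -ex -ey; apply/(fe _ (feq ord0 (lift ord0 ord0)) e).
by rewrite /= ex ey.
Qed.

Theorem theorem2p2 (L : language) (K : set (structure L)) (M : structure L)
    (hK : amalgamation_class K) (hM : fraisse_limit K M) :
  (forall (I : set M) (prec : M -> M -> Prop),
      linear_order_on I prec ->
      (forall n (a : nat -> 'I_n -> M), (1 <= n)%N ->
         exists i j (f : M -> M),
           [/\ (i < j)%N,
               elementary f,
               @embedding _ (expand (order_relations I prec))
                            (expand (order_relations I prec)) f &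
               f \o a i = a j]) ->
      has_omega_categorical_generic M
        (basic_theory (order_relations I prec))) /\
  (forall prec : M -> M -> Prop,
      AZ_enumeration prec ->
      has_omega_categorical_generic M
        (basic_theory (order_relations [set: M]%classic prec))).
Proof.
have [cM uhM _] := hM.
have main (I : set M) (prec : M -> M -> Prop) :
    (forall n (a : nat -> 'I_n -> M), (1 <= n)%N ->
      exists i j (f : M -> M),
        [/\ (i < j)%N, elementary f,
            @embedding _ (expand (order_relations I prec))
                         (expand (order_relations I prec)) f &
            f \o a i = a j]) ->
    has_omega_categorical_generic M (basic_theory (order_relations I prec)).
  move=> H; apply: self_embeddings_omega_categorical_generic => // -[|n] a.
    (* The hypothesis starts at [n = 1]; for empty tuples the identity serves. *)
    by exists 0%N, 1%N, id; split=> //; exact: no_varsE.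
  have [i [j [f [ij fe [_ fE] fa]]]] := H n.+1 a isT.
  by exists i, j, f; split=> // r v _; apply: (fE (inr r) v).
split=> [I prec _|prec [[_ irr trans total] _ H]]; first exact: main.
apply: main => n a n1; have [i [j [f [ij fe fmono fa]]]] := H n a n1.
have [finj frel] := elementary_embedding fe.
exists i, j, f; split=> //; split=> // -[r|[] /=] v; first exact: frel.
  (* An order-preserving [f] reflects the order: by totality, failure would give the opposite
     relation between the arguments, hence between their images, against irreflexivity. *)
  split=> [/fmono //|fv].
  have ne : v ord0 <> v ord_max by move=> vv; move: fv; rewrite /= vv => /irr.
  have [//|/fmono vf] := total _ _ I I ne.
  by case: (irr _ (trans _ _ _ fv vf)).
by [].
Qed.
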